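(* Let $\alpha>0$ with $\alpha\ne1$ be fixed and $f_i=1/i^\alpha$ for $i\in[n]$. Let $n,B\in\mathbb{N}$ with $2B\le n$, and let $h:[n]\to[B]$ be a $2$-independent hash function. For $i\in[n]\setminus[B]$ define $\tilde f_i=\sum_{j\in[n]\setminus[B]}[h(j)=h(i)]f_j$. Then for every $i\in[n]\setminus[B]$, $$\mathbb{E}[|\tilde f_i-f_i|]=\begin{cases}\Theta\!\left(\frac{n^{1-\alpha}}{B}\right),&\alpha<1,\\ \Theta(B^{-\alpha}),&\alpha>1,\end{cases}$$ with implied constants depending only on $\alpha$.
   Context: $[m]=\{1,\dots,m\}$; $[E]$ is the indicator of event $E$. A hash function $h$ is $2$-independent if for distinct $x,y$ the pair $(h(x),h(y))$ is uniform on $[B]^2$. This models learned Count-Min where the $B$ heaviest items are stored exactly and the rest are sketched with one hash function.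
   Formalization: The lower bound is proved for n > 2, which excludes only n = 2, B = 1, where the sole item outside [B] is i = 2, so the error is 0 and the lower bound fails; the upper bound covers all n, B with B ≥ 1 and 2B ≤ n. *)

(* Defs.v *)
From HB Require Import structures.
From mathcomp Require Import all_boot all_order all_algebra.
From mathcomp Require Import all_classical all_reals all_analysis.

Set Implicit Arguments.
Unset Strict Implicit.
Unset Printing Implicit Defensive.

Import Order.TTheory GRing.Theory Num.Theory.

Local Open Scope classical_set_scope.
Local Open Scope ring_scope.

(* Items 1, ..., n are encoded 0-based: (j : 'I_n) stands for item j.+1, so
   item j.+1 lies outside {1, ..., B} exactly when (B <= j)%N.
   Buckets {1, ..., B} are relabelled as 'I_B. *)

Section Sketch.
Context {R : realType} {n : nat}.

Definition freq (alpha : R) (j : 'I_n) : R := 1 / (j.+1%:R `^ alpha).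

Context {d : measure_display} {T : measurableType d} {B : nat}.

(* A random function h : the outcome w selects the hash function h w. *)
Definition hash_event (h : T -> 'I_n -> 'I_B) (x : 'I_n) (a : 'I_B) : set T :=
  [set w | h w x = a].

Definition two_independent (P : probability T R) (h : T -> 'I_n -> 'I_B) :=
  (forall x a, measurable (hash_event h x a)) /\
  (forall x y, x != y -> forall a b,
     P (hash_event h x a `&` hash_event h y b) = ((B%:R ^+ 2)^-1)%:E).

Definition est_freq (alpha : R) (h : T -> 'I_n -> 'I_B) (i : 'I_n) (w : T) : R :=
  \sum_(j < n | (B <= j)%N) (h w j == h w i)%:R * freq alpha j.

End Sketch.

Definition error_rate {R : realType} (alpha : R) (n B : nat) : R :=
  if alpha < 1 then n%:R `^ (1 - alpha) / B%:R else B%:R `^ (- alpha).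

(* Main.v *)
Require Import Defs.
From HB Require Import structures.
From mathcomp Require Import all_boot all_order all_algebra.
From mathcomp Require Import all_classical all_reals all_analysis.
From mathcomp Require Import measurable_realfun zify ring lra.

Import Order.TTheory GRing.Theory Num.Theory.

Local Open Scope classical_set_scope.
Local Open Scope ring_scope.

(** By 2-independence two distinct items collide with probability [1 / B], so
    the expected error is exactly [1 / B] times the sum of [f_j] over the
    sketched items [j <> i].  That sum is bounded above by telescoping
    [x |-> x^(1 - alpha)], using the tangent inequality
    [t^(-p) >= 1 + p (1 - t)], and below by counting: for any [m <= n] at least
    [m - B - 1] of the terms are at least [m^(-alpha)].  Take [m = n] if
    [alpha < 1] and [m = max(2 B, 3)] if [alpha > 1]. *)

(** * Telescoping bounds for sums of negative powers *)

Section PowerSums.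
Context {R : realType}.
Implicit Types (alpha p t x : R).

Lemma powRN_div alpha x : 0 < x -> x `^ (- alpha) = x `^ (1 - alpha) / x.
Proof.
move=> x0; rewrite -[X in _ / X]powRr1 ?ltW// -powRN -powRD; last first.
  by rewrite (gt_eqF x0) implybT.
by congr (_ `^ _); ring.
Qed.

(** Write the power as [expR (- p * ln t)] and combine [expR y >= 1 + y] with [ln t <= t - 1]. *)
Lemma powRN_ge_tangent p t : 0 <= p -> 0 < t -> 1 + p * (1 - t) <= t `^ (- p).
Proof.
move=> p0 t0; rewrite /powR gt_eqF//.
apply: le_trans (expR_ge1Dx _); rewrite lerD2l mulNr -mulrN.
apply: ler_wpM2l => //; rewrite lerNr opprB.
have := @le_ln1Dx R (t - 1).
by rewrite (_ : 1 + (t - 1) = t); [apply; lra|ring].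
Qed.

(** The tangent inequality at [t = x / (x + 1)], where [1 - t = 1 / (x + 1)]. *)
Lemma powRN_succ_ratio p x : 0 <= p -> 0 < x ->
  1 + p / (x + 1) <= x `^ (- p) * (x + 1) `^ p.
Proof.
move=> p0 x0; have x1 : 0 < x + 1 by lra.
have := @powRN_ge_tangent p (x / (x + 1)) p0 (divr_gt0 x0 x1).
have xV : 0 <= (x + 1)^-1 by rewrite invr_ge0 ltW.
rewrite powRM ?(ltW x0)// [(_^-1) `^ _](_ : _ = (x + 1) `^ p); last first.
  by rewrite -powR_inv1 ?ltW// -powRrM mulN1r opprK.
rewrite (_ : 1 - _ = (x + 1)^-1)//.
by field; rewrite gt_eqF.
Qed.
Arguments powRN_succ_ratio [p x].

(** The ratio bound for [p = alpha - 1], multiplied by [(x + 1) ^ (1 - alpha)]. *)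
Lemma powRN_le_diff_gt1 alpha x : 1 < alpha -> 0 < x ->
  (x + 1) `^ (- alpha) <=
  (x `^ (1 - alpha) - (x + 1) `^ (1 - alpha)) / (alpha - 1).
Proof.
move=> a1 x0; have x1 : 0 < x + 1 by lra.
have p0 : 0 < alpha - 1 by lra.
rewrite ler_pdivlMr// lerBrDl.
rewrite [(x + 1) `^ (- alpha)]powRN_div//.
have := powRN_succ_ratio (ltW p0) x0; rewrite opprB.
have := powR_gt0 (1 - alpha) x1.
have -> : (x + 1) `^ (alpha - 1) = ((x + 1) `^ (1 - alpha))^-1.
  by rewrite -powRN opprB.
move=> y0; rewrite ler_pdivlMr// => h; apply: le_trans h.
by rewrite le_eqVlt; apply/orP; left; apply/eqP; ring.
Qed.
Arguments powRN_le_diff_gt1 [alpha x].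

(** The ratio bound for [p = 1 - alpha] controls the increment through its value at [x]; passing to
    the value at [x + 1] costs the factor 2. *)
Lemma powRN_le_diff_lt1 alpha x : 0 < alpha -> alpha < 1 -> 0 < x ->
  (x + 1) `^ (- alpha) <=
  2 / (1 - alpha) * ((x + 1) `^ (1 - alpha) - x `^ (1 - alpha)).
Proof.
move=> a0 a1 x0; have x1 : 0 < x + 1 by lra.
have p0 : 0 < 1 - alpha by lra.
rewrite [(x + 1) `^ (- alpha)]powRN_div//.
have := powRN_succ_ratio (ltW p0) x0.
have := powR_gt0 (1 - alpha) x0; rewrite powRN.
have := powR_gt0 (1 - alpha) x1.
set Y := (x + 1) `^ _; set y := x `^ _ => Y0 y0.
rewrite [y^-1 * _]mulrC ler_pdivlMr// => h.
have q1 : (1 - alpha) / (x + 1) <= 1 by rewrite ler_pdivrMr//; lra.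
have q0 : 0 < (1 - alpha) / (x + 1) by exact: divr_gt0.
rewrite [leRHS]mulrAC ler_pdivlMr// -mulrA [_^-1 * _]mulrC.
move: ((1 - alpha) / (x + 1)) q0 q1 h => q q0 q1 h.
(* With [q = (1 - alpha) / (x + 1)] the goal amounts to [y <= Y * (1 - q / 2)]. It follows since [(1
   + q) * (1 - q / 2) = 1 + q * (1 - q) / 2] is at least 1. *)
have h2 : (1 + q) * y * (1 - q / 2) <= Y * (1 - q / 2).
  by apply: ler_wpM2r => //; lra.
have : 0 <= y * q * (1 - q) by rewrite !mulr_ge0 ?subr_ge0// ltW.
nra.
Qed.

Lemma sum_powRN_le_gt1 alpha (m n : nat) : 1 < alpha -> (0 < m <= n)%N ->
  \sum_(m <= k < n) (k.+1%:R : R) `^ (- alpha) <=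
  m%:R `^ (1 - alpha) / (alpha - 1).
Proof.
move=> a1 /andP[m0 mn].
have p0 : 0 < alpha - 1 by lra.
(* The sign makes [G] increasing, as [1 - alpha < 0]; after telescoping, [G n <= 0] is dropped. *)
pose G k : R := - (k%:R `^ (1 - alpha) / (alpha - 1)).
apply: (@le_trans _ _ (\sum_(m <= k < n) (G k.+1 - G k))).
  apply: ler_sum_nat => k /andP[mk _].
  have k0 : 0 < k%:R :> R by rewrite ltr0n; exact: leq_trans mk.
  rewrite -natr1; apply: le_trans (powRN_le_diff_gt1 a1 k0) _.
  by rewrite /G -natr1 mulrBl opprK addrC.
rewrite telescope_sumr// /G opprK gerDr oppr_le0.
by rewrite divr_ge0 ?powR_ge0 ?ltW.
Qed.

Lemma sum_powRN_le_lt1 alpha (m n : nat) :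
  0 < alpha -> alpha < 1 -> (0 < m <= n)%N ->
  \sum_(m <= k < n) (k.+1%:R : R) `^ (- alpha) <=
  2 / (1 - alpha) * n%:R `^ (1 - alpha).
Proof.
move=> a0 a1 /andP[m0 mn].
have p0 : 0 < 1 - alpha by lra.
pose G k : R := 2 / (1 - alpha) * k%:R `^ (1 - alpha).
apply: (@le_trans _ _ (\sum_(m <= k < n) (G k.+1 - G k))).
  apply: ler_sum_nat => k /andP[mk _].
  have k0 : 0 < k%:R :> R by rewrite ltr0n; exact: leq_trans mk.
  by rewrite /G -mulrBr -natr1; exact: powRN_le_diff_lt1.
rewrite telescope_sumr// /G gerDl oppr_le0.
by rewrite mulr_ge0 ?powR_ge0// divr_ge0 ?ltW.
Qed.

(** * Bounds on the total frequency of the sketched items other than [i] *)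

Lemma freqE n alpha (j : 'I_n) : freq alpha j = j.+1%:R `^ (- alpha).
Proof. by rewrite /freq powRN div1r. Qed.

Lemma freq_ge0 n alpha (j : 'I_n) : 0 <= freq alpha j.
Proof. by rewrite freqE powR_ge0. Qed.

Lemma sum_freqD1_le alpha (n B : nat) (i : 'I_n) :
  \sum_(j < n | (B <= j)%N && (j != i)) freq alpha j <=
  \sum_(B <= k < n) k.+1%:R `^ (- alpha).
Proof.
rewrite big_geq_mkord [leRHS](bigID (fun j : 'I_n => j != i))/=.
under eq_bigr do rewrite freqE.
by rewrite lerDl sumr_ge0// => j _; rewrite powR_ge0.
Qed.

Lemma sum_freqD1_ge alpha (n B m : nat) (i : 'I_n) :
  0 < alpha -> (B <= i)%N -> (B < m <= n)%N ->
  (m - B.+1)%:R * m%:R `^ (- alpha) <=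
  \sum_(j < n | (B <= j)%N && (j != i)) freq alpha j.
Proof.
move=> a0 Bi /andP[Bm mn]; set c := m%:R `^ _.
have c0 : 0 <= c by rewrite powR_ge0.
(* Cutting off at [m] keeps [F] below the frequencies on the whole range. *)
pose F k := if (k < m)%N then c else 0.
have Fc k : F k <= c by rewrite /F; case: ifP.
have F0 k : 0 <= F k by rewrite /F; case: ifP.
have le_F (j : 'I_n) : F j <= freq alpha j.
  rewrite /F; case: ifPn => [jm|_]; last exact: freq_ge0.
  rewrite freqE /c !powRN lef_pV2 ?posrE ?powR_gt0 ?ltr0n//; last by lia.
  by apply: ge0_ler_powR; rewrite ?nnegrE ?ler0n ?ler_nat// ltW.
(* Leaving out [i] loses at most one [c], whether or not [i < m]; hence the count [m - B.+1]. *)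
have le_sum : \sum_(B <= k < n) F k <=
    c + \sum_(j < n | (B <= j)%N && (j != i)) freq alpha j.
  rewrite big_geq_mkord/= (bigD1 i)//=.
  by apply: lerD => //; apply: ler_sum => j _; exact: le_F.
have : (m - B)%:R * c <= \sum_(B <= k < n) F k.
  rewrite (@big_cat_nat _ _ _ m)//=; last exact: ltnW.
  rewrite [X in _ <= X + _](_ : _ = (m - B)%:R * c).
    by rewrite lerDl sumr_ge0.
  rewrite mulr_natl -sumr_const_nat; apply: eq_big_nat => k /andP[_ km].
  by rewrite /F km.
have -> : (m - B)%N = (m - B.+1).+1 by lia.
rewrite -natr1 mulrDl mul1r => h; move: (le_trans h le_sum).
by rewrite addrC lerD2l.
Qed.

End PowerSums.

(** * Collision probabilities and the exact expected error *)

Section CollisionProbability.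
Context {R : realType} {d : measure_display} {T : measurableType d}.
Context (P : probability T R) {n B : nat} (h : T -> 'I_n -> 'I_B).
Context (h2 : two_independent P h).

Definition collision (j i : 'I_n) : set T := [set w | h w j == h w i].

Lemma collision_bigU j i : collision j i =
  \big[setU/set0]_(a < B) (hash_event h j a `&` hash_event h i a).
Proof.
rewrite -bigcup_seq /collision /hash_event; apply/seteqP; split => w /=.
  by move=> /eqP hji; exists (h w i); rewrite /= ?mem_index_enum.
by move=> [a _ [-> ->]].
Qed.

Lemma measurable_collision j i : measurable (collision j i).
Proof.
rewrite collision_bigU; apply: bigsetU_measurable => a _.
by apply: measurableI; apply: h2.1.
Qed.

(** Split by the common bucket: [B] disjoint events, each of probability [1 / B^2]. *)
Lemma prob_collision j i : (0 < B)%N -> j != i ->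
  P (collision j i) = (B%:R^-1)%:E.
Proof.
move=> B0 ji; rewrite collision_bigU measure_bigsetU_ord; last 2 first.
- by move=> a; apply: measurableI; apply: h2.1.
- apply/trivIsetP => a b _ _ ab; apply/seteqP; split => // w [[+ _] [+ _]].
  by rewrite /hash_event /= => -> /eqP; rewrite (negbTE ab).
rewrite (eq_bigr (fun=> ((B%:R ^+ 2)^-1)%:E)); last first.
  by move=> a _; exact: h2.2.
rewrite sumEFin sumr_const card_ord; congr EFin.
rewrite -mulr_natr; field.
by rewrite pnatr_eq0 -lt0n.
Qed.

Lemma expected_errorE alpha (i : 'I_n) : (0 < B)%N -> (B <= i)%N ->
  ('E_P[fun w => `|est_freq alpha h i w - freq alpha i|%R] =
   (B%:R^-1 * \sum_(j < n | (B <= j)%N && (j != i)) freq alpha j)%:E)%E.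
Proof.
move=> B0 Bi; rewrite unlock.
pose F j w : \bar R := ((freq alpha j)%:E * (\1_(collision j i) w : R)%:E)%E.
have F0 j w : (0 <= F j w)%E.
  by rewrite mule_ge0// lee_fin ?freq_ge0.
have mF j : measurable_fun setT (F j).
  apply/measurable_EFinP; apply: measurable_funM => //.
  by apply: measurable_indic; exact: measurable_collision.
transitivity (\int[P]_w \sum_(j < n | (B <= j)%N && (j != i)) F j w)%E.
  apply: eq_integral => w _; rewrite sumEFin; congr EFin.
  (* Item [i] collides with itself and contributes exactly [freq alpha i], so the error is a
     nonnegative sum and the absolute value disappears. *)
  rewrite /est_freq (bigD1 i)//= eqxx mul1r addrAC subrr add0r ger0_norm.
    by apply: eq_bigr => j _; rewrite indicE mulrC /collision mem_setE.
  by apply: sumr_ge0 => j _; rewrite mulr_ge0 ?freq_ge0.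
under eq_integral do rewrite -big_filter.
rewrite ge0_integral_sum//.
rewrite big_filter mulr_sumr -sumEFin; apply: eq_bigr => j /andP[_ ji].
rewrite ge0_integralZl_EFin ?freq_ge0//; last first.
  apply/measurable_EFinP.
  by apply: measurable_indic; exact: measurable_collision.
rewrite integral_indic//; last exact: measurable_collision.
by rewrite setIT mulrC [RHS]EFinM -(prob_collision _ _ B0 ji).
Qed.

End CollisionProbability.

(* The lower bound is asked for n > 2, which excludes only (n, B) = (2, 1):
   there i = 2 is the only sketched item, so the error is identically 0. *)
Theorem theoremA4 (R : realType) (alpha : R) :
  0 < alpha -> alpha != 1 ->
  exists c C : R, [/\ 0 < c, 0 < C &
    forall (d : measure_display) (T : measurableType d) (P : probability T R)
      (n B : nat) (h : T -> 'I_n -> 'I_B),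
    (0 < B)%N -> (2 * B <= n)%N -> two_independent P h ->
    forall i : 'I_n, (B <= i)%N ->
      let err := ('E_P[fun w => (`|est_freq alpha h i w - freq alpha i|)%R])%E in
      ((2 < n)%N -> ((c * error_rate alpha n B)%:E <= err)%E) /\
      (err <= (C * error_rate alpha n B)%:E)%E].
Proof.
move=> a0 aN1; rewrite /error_rate; case: ltP => [a1|a1'].
(* The 1/4 comes from [n - B - 1 >= n / 4], valid for [2 * B <= n] and [n > 2], with equality at
   [n = 4], [B = 2]. *)
- exists (4^-1), (2 / (1 - alpha)); split; [lra|apply: divr_gt0; lra|].
  move=> d T P n B h B0 Bn h2 i Bi /=; rewrite expected_errorE// !lee_fin.
  have Bp : 0 < B%:R^-1 :> R by rewrite invr_gt0 ltr0n.
  rewrite !mulrA ![_ * B%:R^-1]mulrC !ler_pM2l//.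
  split => [n2|].
    apply: le_trans (@sum_freqD1_ge R alpha n B n i a0 Bi _); last by lia.
    have n0 : n%:R != 0 :> R by rewrite pnatr_eq0; lia.
    rewrite powRD ?n0 ?implybT// powRr1 ?ler0n// mulrA.
    apply: ler_wpM2r; first exact: powR_ge0.
    rewrite mulrC ler_pdivrMr// -natrM ler_nat; lia.
  apply: le_trans (sum_freqD1_le _ _ _ _) _.
  by apply: sum_powRN_le_lt1 => //; lia.
- have a1 : 1 < alpha by rewrite lt_neqAle eq_sym aN1.
  (* For [m = max(2 B, 3)] one has [m - B - 1 >= B / 2] and [m <= 3 * B]; these give the two factors
     of the lower constant. *)
  exists (2^-1 * 3 `^ (- alpha)), ((alpha - 1)^-1); split.
  + by rewrite mulr_gt0 ?powR_gt0.
  + by rewrite invr_gt0; lra.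
  move=> d T P n B h B0 Bn h2 i Bi /=; rewrite expected_errorE// !lee_fin.
  have Bp : 0 < B%:R :> R by rewrite ltr0n.
  rewrite [B%:R^-1 * _]mulrC ler_pdivlMr// ler_pdivrMr//.
  split => [n2|].
    (* The 3 matters at [B = 1], where [2 * B] would leave no term to count. *)
    pose m := maxn (2 * B) 3.
    apply: le_trans (@sum_freqD1_ge R alpha n B m i a0 Bi _); last by lia.
    have -> : 2^-1 * 3 `^ (- alpha) * B%:R `^ (- alpha) * B%:R =
              (B%:R / 2) * ((3 * B)%:R `^ (- alpha)) :> R.
      by rewrite natrM powRM ?ler0n//; ring.
    apply: ler_pM; rewrite ?powR_ge0 ?divr_ge0 ?ler0n//.
      rewrite ler_pdivrMr// -natrM ler_nat; lia.
    rewrite !powRN lef_pV2 ?posrE ?powR_gt0 ?ltr0n//; [|lia|lia].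
    by apply: ge0_ler_powR; rewrite ?nnegrE ?ler0n ?ler_nat//; [exact: ltW|lia].
  apply: le_trans (sum_freqD1_le _ _ _ _) _.
  apply: le_trans (sum_powRN_le_gt1 _ _ _ a1 _) _; first by lia.
  rewrite powRD; last by rewrite (gt_eqF Bp) implybT.
  rewrite powRr1 ?ler0n//.
  by rewrite le_eqVlt; apply/orP; left; apply/eqP; ring.
Qed.
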